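(* Let $A_n$ be a self-adjoint operator in a Hilbert space $\mathcal H_n$ for each $n\in\overline{\mathbb N}$. If $(A_n)_{n\in\mathbb N}$ QUE-converges to $A_\infty$ at $z_0$ with identification operators $J_n$ fulfilling $\|J_n\|\le1$ for all $n\in\mathbb N$ and with convergence speed $(\delta_n)_n$, then $(A_n)_{n\in\mathbb N}$ Weidmann-converges to $A_\infty$ at $z_0$ with convergence speed $$\widetilde\delta_n:=\delta_n^{1/2}\cdot\Bigl(2\bigl(\|R_\infty\|_{\mathcal L(\mathcal H_\infty)}+2\delta_n\bigr)^{1/2}+\delta_n^{1/2}\Bigr)\in\mathrm O(\delta_n^{1/2}),$$ where $R_\infty=(A_\infty-z_0)^{-1}$.
   Context: All Hilbert spaces are complex and separable; $\mathbb N=\{1,2,\dots\}$, $\overline{\mathbb N}=\mathbb N\cup\{\infty\}$; $\mathcal L(\mathcal H)$ denotes bounded operators on $\mathcal H$; norms of operators are operator norms; $\rho(A)$ is the resolvent set. For $z_0\in\bigcap_{n\in\overline{\mathbb N}}\rho(A_n)$ write $R_n:=(A_n-z_0)^{-1}$, $n\in\overline{\mathbb N}$. Let $(\delta_n)_{n\in\mathbb N}$ be a sequence in $[0,\infty)$ with $\delta_n\to0$. $(A_n)_{n\in\mathbb N}$ Weidmann-converges to $A_\infty$ at $z_0$ with convergence speed $(\delta_n)_n$ if there exist a Hilbert space $\mathcal H$ and isometries $\iota_n:\mathcal H_n\to\mathcal H$ ($n\in\overline{\mathbb N}$) such that $\|\iota_nR_n\iota_n^*-\iota_\infty R_\infty\iota_\infty^*\|\le\delta_n$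 for all $n\in\mathbb N$. $(A_n)_{n\in\mathbb N}$ QUE-converges to $A_\infty$ at $z_0$ with identification operators $(J_n)_n$ and convergence speed $(\delta_n)_n$ if $J_n:\mathcal H_n\to\mathcal H_\infty$ ($n\in\mathbb N$) are bounded operators such that for all $n\in\mathbb N$: (i) $\|J_n\|\le1+\delta_n$; (ii) $\|(\mathrm{id}_{\mathcal H_n}-J_n^*J_n)R_n\|\le\delta_n$ and $\|(\mathrm{id}_{\mathcal H_\infty}-J_nJ_n^* )R_\infty\|\le\delta_n$; (iii) $\|R_\infty J_n-J_nR_n\|\le\delta_n$; and, if $z_0\in\mathbb C\setminus\mathbb R$, (ii) and (iii) also hold with $R_n,R_\infty$ replaced by $R_n^*,R_\infty^*$. *)

(* Defs.v *)
From HB Require Import structures.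
From mathcomp Require Import all_boot all_order all_algebra sesquilinear complex.
From mathcomp Require Import all_classical all_reals all_analysis.

Set Implicit Arguments.
Unset Strict Implicit.
Unset Printing Implicit Defensive.

Import Order.TTheory GRing.Theory Num.Theory.
Import numFieldNormedType.Exports.

Local Open Scope classical_set_scope.
Local Open Scope ring_scope.

Definition separable_space (T : topologicalType) : Prop :=
  exists2 S : set T, countable S & dense S.

(* The norm of a normed module over R[i] takes its values in R[i]. As in
   [sesquilinear], [dotp] is linear in its first argument and conjugate-linear
   in its second one. *)
HB.mixin Record CompleteNormedModule_isHilbert (R : realType) H
    of CompleteNormedModule R[i] H := {
  dotp : {dot H for Num.conj};
  dotp_norm : forall x : H, dotp x x = `|x| ^+ 2;
  hilbert_separable : separable_space H
}.

#[short(type="hilbertType")]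
HB.structure Definition Hilbert (R : realType) :=
  {H of CompleteNormedModule R[i] H & CompleteNormedModule_isHilbert R H}.

Section BoundedOperators.
Context {R : realType}.
Implicit Types H K : hilbertType R.

Definition hnorm {H} (x : H) : R := complex.Re `|x|.

(* Junk value if [f] is unbounded. *)
Definition opnorm {H K} (f : H -> K) : R :=
  sup [set hnorm (f x) | x in [set x : H | hnorm x <= 1]].

Definition bounded_op {H K} (f : H -> K) : Prop :=
  linear f /\ bounded_near f (nbhs (0 : H)).

(* By the Riesz representation theorem the set below is a singleton as soon as
   [f] is a bounded operator. *)
Definition adjoint {H K} (f : H -> K) : K -> H :=
  xget (fun=> 0) [set g : K -> H | forall x y, dotp (f x) y = dotp x (g y)].

Definition isometric {H K} (f : H -> K) : Prop :=
  linear f /\ forall x, `|f x| = `|x|.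

End BoundedOperators.

Section UnboundedOperators.
Context {R : realType}.

(* A linear operator defined on the subspace [dom] of H; the values of [op_fun]
   outside [dom] are irrelevant. *)
Record operator (H : hilbertType R) := Operator {
  dom : set H;
  op_fun :> H -> H;
  dom_zero : dom 0;
  dom_linear : forall (a : R[i]) x y, dom x -> dom y -> dom (a *: x + y);
  op_linear : forall (a : R[i]) x y, dom x -> dom y ->
    op_fun (a *: x + y) = a *: op_fun x + op_fun y
}.

Context {H : hilbertType R}.
Implicit Types (A : operator H) (z : R[i]).

Definition graph A : set (H * H) :=
  [set p | dom A p.1 /\ A p.1 = p.2].

Definition adjoint_graph A : set (H * H) :=
  [set p | forall x, dom A x -> dotp (A x) p.1 = dotp x p.2].

Definition self_adjoint A : Prop :=
  dense (dom A) /\ adjoint_graph A = graph A.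

Definition is_resolvent A z (S : H -> H) : Prop :=
  [/\ bounded_op S,
      forall y, dom A (S y) /\ A (S y) - z *: S y = y
    & forall x, dom A x -> S (A x - z *: x) = x].

Definition resolvent_set A : set R[i] :=
  [set z | exists S, is_resolvent A z S].

Definition resolvent A z : H -> H := xget (fun=> 0) [set S | is_resolvent A z S].

End UnboundedOperators.

Section Convergence.
Context {R : realType}.

Definition convergence_speed (delta : nat -> R) : Prop :=
  (forall n, 0 <= delta n) /\ delta @ \oo --> (0 : R).

(* The spaces and operators with index n in {1, 2, ...} are families over [nat]
   (shifted by one); the index infinity is treated apart. *)
Context (H : nat -> hilbertType R) (Hoo : hilbertType R).
Context (A : forall n, operator (H n)) (Aoo : operator Hoo) (z0 : R[i]).

Definition common_resolvent_point : Prop :=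
  (forall n, resolvent_set (A n) z0) /\ resolvent_set Aoo z0.

Definition weidmann_converges (delta : nat -> R) : Prop :=
  [/\ convergence_speed delta, common_resolvent_point
    & exists (K : hilbertType R) (iota : forall n, H n -> K) (iotaoo : Hoo -> K),
      [/\ forall n, isometric (iota n), isometric iotaoo
        & forall n,
          opnorm ((iota n \o resolvent (A n) z0 \o adjoint (iota n))
                  \- (iotaoo \o resolvent Aoo z0 \o adjoint iotaoo)) <= delta n]].

(* Conditions (ii) and (iii) at one index, for operators [Rn] and [Roo] standing
   for the resolvents or for their adjoints. *)
Definition quasi_unitary {Hn : hilbertType R} (J : Hn -> Hoo)
    (Rn : Hn -> Hn) (Roo : Hoo -> Hoo) (d : R) : Prop :=
  [/\ opnorm ((idfun \- (adjoint J \o J)) \o Rn) <= d,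
      opnorm ((idfun \- (J \o adjoint J)) \o Roo) <= d
    & opnorm ((Roo \o J) \- (J \o Rn)) <= d].

Definition que_converges (J : forall n, H n -> Hoo) (delta : nat -> R) : Prop :=
  [/\ convergence_speed delta, common_resolvent_point,
      forall n, bounded_op (J n)
    & forall n,
      [/\ opnorm (J n) <= 1 + delta n,
          quasi_unitary (J n) (resolvent (A n) z0) (resolvent Aoo z0) (delta n)
        & z0 \isn't Num.real ->
          quasi_unitary (J n) (adjoint (resolvent (A n) z0))
            (adjoint (resolvent Aoo z0)) (delta n)]].

End Convergence.

(* Main.v *)
(* The identification operators J_n are contractions, so H_n embeds isometrically
   in a common Hilbert space over H_oo by iota_n f = (J_n f, V_n f), where
   |V_n f|^2 = |f|^2 - |J_n f|^2, while iota_oo g = (g, 0). The defect maps V_n are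
   obtained without operator square roots: successive projections along a dense
   sequence, orthogonal for the positive form <f, g> - <J_n f, J_n g>, give
   coordinates of f in l2 that satisfy Parseval's identity for this form.
   Since iota_oo^* iota_n = J_n, the difference of the lifted resolvents is
     (iota_n - iota_oo J_n) R_n iota_n^* - iota_oo (R_oo J_n - J_n R_n) iota_n^*
       + iota_oo R_oo (J_n iota_n^* - iota_oo^* ).
   The middle term has norm at most delta_n. The outer ones have norm at most
   (delta_n (|R_oo| + 2 delta_n))^(1/2), because
     |(iota_n - iota_oo J_n) f|^2 = <(1 - J_n^* J_n) f, f>   and
     |(iota_n J_n^* - iota_oo) g|^2 = <(1 - J_n J_n^* ) g, g>. *)

From HB Require Import structures.
Require Import Defs.
From mathcomp Require Import all_boot all_order all_algebra sesquilinear complex.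
From mathcomp Require Import all_classical all_reals all_analysis.
From mathcomp Require Import ring lra.

Set Implicit Arguments.
Unset Strict Implicit.
Unset Printing Implicit Defensive.

Import Order.TTheory GRing.Theory Num.Theory.
Import numFieldNormedType.Exports.

Local Open Scope classical_set_scope.
Local Open Scope ring_scope.

(** * Positive sesquilinear forms *)

Section ComplexParts.
Context {R : realType}.
Implicit Types z w : R[i].

Definition normsq z : R := complex.Re z ^+ 2 + complex.Im z ^+ 2.

Lemma normsq_ge0 z : 0 <= normsq z.
Proof. by rewrite addr_ge0 ?sqr_ge0. Qed.

Lemma ReD z w : complex.Re (z + w) = complex.Re z + complex.Re w.
Proof. by case: z w => [? ?] [? ?]. Qed.

Lemma ImD z w : complex.Im (z + w) = complex.Im z + complex.Im w.
Proof. by case: z w => [? ?] [? ?]. Qed.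

Lemma ReN z : complex.Re (- z) = - complex.Re z.
Proof. by case: z. Qed.

Lemma ReB z w : complex.Re (z - w) = complex.Re z - complex.Re w.
Proof. by rewrite ReD ReN. Qed.

Lemma ImN z : complex.Im (- z) = - complex.Im z.
Proof. by case: z. Qed.

Lemma ReM z w : complex.Re (z * w) =
  complex.Re z * complex.Re w - complex.Im z * complex.Im w.
Proof. by case: z w => [? ?] [? ?]. Qed.

Lemma ImM z w : complex.Im (z * w) =
  complex.Re z * complex.Im w + complex.Im z * complex.Re w.
Proof. by case: z w => [? ?] [? ?]. Qed.

Lemma Re_conj z : complex.Re (Num.conj z) = complex.Re z.
Proof. by case: z. Qed.

Lemma Im_conj z : complex.Im (Num.conj z) = - complex.Im z.
Proof. by case: z. Qed.

Lemma complex_eq z w :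
  complex.Re z = complex.Re w -> complex.Im z = complex.Im w -> z = w.
Proof. by case: z w => [? ?] [? ?] /= -> ->. Qed.

(** Multiplication by i reduces a claim on imaginary parts to the same claim on real parts. *)
Lemma Im_Re z : complex.Im z = - complex.Re ('i%C * z).
Proof. by case: z => a b /=; rewrite mul0r mul1r sub0r opprK. Qed.

Lemma normsqE z : `|z| = (Num.sqrt (normsq z))%:C%C.
Proof. exact: normc_def. Qed.

Lemma normsqM z w : normsq (z * w) = normsq z * normsq w.
Proof. by rewrite /normsq ReM ImM; ring. Qed.

Lemma normsq_divr z (r : R) : normsq (z / r%:C%C) = normsq z / r ^+ 2.
Proof.
by rewrite -fmorphV normsqM {2}/normsq/= expr0n addr0 exprVn.
Qed.

Lemma normsq_eq0 z : normsq z = 0 -> z = 0.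
Proof.
move=> /eqP; rewrite paddr_eq0 ?sqr_ge0// !sqrf_eq0 => /andP[/eqP h /eqP k].
exact: complex_eq.
Qed.

End ComplexParts.

Section PositiveForm.
Context {R : realType} {U : lmodType R[i]}.

(** Only semidefinite: the defect form of a contraction vanishes on the vectors whose norm the
    contraction preserves. *)
Definition positive_form (B : U -> U -> R[i]) : Prop :=
  [/\ forall a x y z, B (a *: x + y) z = a * B x z + B y z,
      forall x y, B y x = Num.conj (B x y)
    & forall x, 0 <= B x x].

Definition quad (B : U -> U -> R[i]) (x : U) : R := complex.Re (B x x).

Context (B : U -> U -> R[i]) (Bpos : positive_form B).
Implicit Types (x y z : U) (a : R[i]).

Let B0l z : B 0 z = 0.
Proof.
case: Bpos => + _ _ => /(_ 1 0 0 z); rewrite scaler0 addr0 mul1r => /eqP.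
by rewrite -subr_eq subrr eq_sym => /eqP.
Qed.

Lemma positive_formDl x y z : B (x + y) z = B x z + B y z.
Proof. by case: Bpos => + _ _ => /(_ 1 x y z); rewrite scale1r mul1r. Qed.

Lemma positive_formZl a x z : B (a *: x) z = a * B x z.
Proof. by case: Bpos => + _ _ => /(_ a x 0 z); rewrite !addr0 B0l addr0. Qed.

Lemma positive_formC x y : B y x = Num.conj (B x y).
Proof. by case: Bpos. Qed.

Lemma positive_formZr a x z : B x (a *: z) = Num.conj a * B x z.
Proof. by rewrite positive_formC positive_formZl rmorphM/= -positive_formC. Qed.

Lemma positive_formDr x y z : B x (y + z) = B x y + B x z.
Proof. by rewrite positive_formC positive_formDl rmorphD/= -!positive_formC. Qed.

Lemma positive_formNl x z : B (- x) z = - B x z.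
Proof. by rewrite -scaleN1r positive_formZl mulN1r. Qed.

Lemma positive_formNr x z : B x (- z) = - B x z.
Proof. by rewrite -scaleN1r positive_formZr rmorphN1 mulN1r. Qed.

Lemma Re_form_sym x y : complex.Re (B x y) = complex.Re (B y x).
Proof. by rewrite positive_formC Re_conj. Qed.

Lemma form_quadE x : B x x = (quad B x)%:C%C.
Proof. by case: Bpos => _ _ /(_ x) /ger0_real/RRe_real. Qed.

Lemma quad_ge0 x : 0 <= quad B x.
Proof. by case: Bpos => _ _ /(_ x); rewrite form_quadE ler0c. Qed.

Lemma quadD x y : quad B (x + y) = quad B x + quad B y + 2 * complex.Re (B x y).
Proof.
rewrite /quad positive_formDl !positive_formDr !ReD (Re_form_sym y x); ring.
Qed.

Lemma quadN x : quad B (- x) = quad B x.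
Proof. by rewrite /quad positive_formNl positive_formNr opprK. Qed.

Lemma quadB x y : quad B (x - y) = quad B x + quad B y - 2 * complex.Re (B x y).
Proof. by rewrite quadD quadN positive_formNr ReN mulrN. Qed.

Lemma quadZ a x : quad B (a *: x) = normsq a * quad B x.
Proof.
rewrite {1}/quad positive_formZl positive_formZr form_quadE !ReM ImM.
by rewrite Re_conj Im_conj /normsq/=; ring.
Qed.

Lemma quadD_le x y : quad B (x + y) <= 2 * quad B x + 2 * quad B y.
Proof. by have := quad_ge0 (x - y); rewrite quadB quadD; lra. Qed.

(** For real t, [quad B (x - t y)] is a nonnegative polynomial in t of degree at most 2; evaluation
    at a well-chosen t gives the bound, including for degenerate [y]. *)
Lemma form_CauchySchwarz x y : complex.Re (B x y) ^+ 2 <= quad B x * quad B y.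
Proof.
set b := complex.Re (B x y).
have P t : 0 <= quad B x + t ^+ 2 * quad B y - 2 * t * b.
  have := quad_ge0 (x - (t%:C)%C *: y).
  by rewrite quadB quadZ /normsq/= positive_formZr ReM Re_conj Im_conj/= -/b; lra.
have := quad_ge0 y; rewrite le_eqVlt => /orP[/eqP y0|y0].
  rewrite -y0 mulr0.
  have [->|b0] := eqVneq b 0; first by rewrite expr0n.
  (* When [quad B y = 0] the polynomial is affine in t, and this t gives it the value -1, which is
     absurd. *)
  have := P ((quad B x + 1) / (2 * b)); rewrite -y0.
  have -> : 2 * ((quad B x + 1) / (2 * b)) * b = quad B x + 1 by field.
  lra.
(* The minimiser of the polynomial. *)
have := P (b / quad B y).
have -> : quad B x + (b / quad B y) ^+ 2 * quad B y - 2 * (b / quad B y) * b =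
   (quad B x * quad B y - b ^+ 2) / quad B y by field; rewrite gt_eqF.
by rewrite pmulr_lge0 ?invr_gt0// subr_ge0.
Qed.

Lemma Re_form_le x y :
  complex.Re (B x y) <= Num.sqrt (quad B x) * Num.sqrt (quad B y).
Proof.
rewrite -sqrtrM ?quad_ge0// (le_trans (ler_norm _))//.
by rewrite -sqrtr_sqr ler_sqrt ?mulr_ge0 ?quad_ge0 ?form_CauchySchwarz.
Qed.

Lemma sqrt_quadD x y :
  Num.sqrt (quad B (x + y)) <= Num.sqrt (quad B x) + Num.sqrt (quad B y).
Proof.
rewrite -(ler_pXn2r (_ : 0 < 2)%N) ?nnegrE ?addr_ge0 ?sqrtr_ge0//.
rewrite sqrrD !sqr_sqrtr ?quad_ge0// quadD.
by have := Re_form_le x y; lra.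
Qed.

(** * Successive projections *)

Context (s : nat -> U).

(* [residual n x] is the component of [x] that is [B]-orthogonal to
   s 0, ..., s (n - 1). Where [B u u = 0], division by zero makes the correction
   vanish, so that degenerate directions are skipped. *)
Fixpoint residual (n : nat) (x : U) : U :=
  if n is m.+1 then
    residual m x - (B (residual m x) (residual m (s m))
                    / B (residual m (s m)) (residual m (s m)))
                   *: residual m (s m)
  else x.

(** The coordinate along the n-th Gram-Schmidt vector [residual n (s n)], normalised; division by
    zero makes it 0 if that vector is degenerate. *)
Definition coefficient (n : nat) (x : U) : R[i] :=
  B (residual n x) (residual n (s n))
  / (Num.sqrt (quad B (residual n (s n))))%:C%C.

Lemma residual_linear n : linear (residual n).
Proof.
elim: n => [//|n IH] a x y /=.
rewrite IH positive_formDl positive_formZl mulrDl scalerDl -mulrA -scalerA.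
by rewrite scalerBr opprD addrACA.
Qed.

Lemma coefficient_linear n a x y :
  coefficient n (a *: x + y) = a * coefficient n x + coefficient n y.
Proof.
by rewrite /coefficient residual_linear positive_formDl positive_formZl mulrDl mulrA.
Qed.

Lemma residualD n x y : residual n (x + y) = residual n x + residual n y.
Proof. by have := residual_linear n 1 x y; rewrite !scale1r. Qed.

(** Pythagoras: step n removes from [residual n x] its projection on [residual n (s n)]. In a
    degenerate direction both the projection and the coefficient are 0. *)
Lemma quad_residualS n x :
  quad B (residual n.+1 x) = quad B (residual n x) - normsq (coefficient n x).
Proof.
rewrite /= /coefficient; set y := residual n x; set u := residual n (s n).
rewrite quadB quadZ positive_formZr form_quadE.
set q := quad B u; set b := B y u.
have q0 : 0 <= q := quad_ge0 u.
have -> : complex.Re (Num.conj (b / q%:C%C) * b) = normsq b / q.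
  by rewrite -fmorphV rmorphM/= ReM ReM ImM !Re_conj !Im_conj/= /normsq; ring.
rewrite !normsq_divr sqr_sqrtr//.
have [->|q_neq0] := eqVneq q 0; first by rewrite invr0; ring.
by field.
Qed.

Lemma sum_normsq_coefficient n x :
  \sum_(k < n) normsq (coefficient k x) = quad B x - quad B (residual n x).
Proof.
elim: n => [|n IH]; first by rewrite big_ord0 /= subrr.
by rewrite big_ord_recr/= IH quad_residualS; ring.
Qed.

Lemma quad_residual_le n x : quad B (residual n x) <= quad B x.
Proof.
by rewrite -subr_ge0 -sum_normsq_coefficient sumr_ge0// => k _; exact: normsq_ge0.
Qed.

(** At step k the residual of [s k] is itself the direction projected out, so that nothing of
    positive length is left; later steps cannot increase [quad]. *)
Lemma quad_residual_eq0 n k : (k < n)%N -> quad B (residual n (s k)) = 0.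
Proof.
elim: n => // n IH; rewrite ltnS leq_eqVlt => /predU1P[->|kn]; last first.
  apply/eqP; rewrite eq_le quad_ge0 andbT quad_residualS IH//.
  by rewrite sub0r oppr_le0 normsq_ge0.
rewrite quad_residualS /coefficient form_quadE.
set q := quad B _.
have q0 : 0 <= q := quad_ge0 _.
rewrite normsq_divr sqr_sqrtr// /normsq/= expr0n addr0.
have [->|q_neq0] := eqVneq q 0; first by rewrite invr0; ring.
by field.
Qed.

(** The gap in Bessel's inequality is [quad] of [residual n x]. Once n > k the residual of [s k] is
    degenerate, so the gap is at most twice [quad B (x - s k)]. *)
Lemma coefficient_Parseval x :
  (forall e : R, 0 < e -> exists k, quad B (x - s k) <= e) ->
  (fun n => \sum_(k < n) normsq (coefficient k x)) @ \oo --> (quad B x : R).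
Proof.
move=> sx; apply/cvgrPdist_le => /= e e0.
have [k kP] := sx (e / 2) (divr_gt0 e0 (ltr0Sn _ 1)).
near=> n.
rewrite sum_normsq_coefficient opprB addrC subrK ger0_norm ?quad_ge0//.
rewrite -(subrK (s k) x) residualD (le_trans (quadD_le _ _))//.
rewrite (@quad_residual_eq0 n k); last by near: n; exists k.+1.
by have := quad_residual_le n (x - s k); lra.
Unshelve. all: by end_near. Qed.

End PositiveForm.

(** * The Hilbert space l2 *)

Section SquareSummable.
Context {R : realType}.
Implicit Types a b c : nat -> R[i].

Definition partial_dot (n : nat) a b : R[i] := \sum_(k < n) a k * Num.conj (b k).

Lemma partial_dot_positive n : positive_form (partial_dot n).
Proof.
split=> [z a b c|a b|a]; rewrite /partial_dot.
- rewrite mulr_sumr -big_split/=; apply: eq_bigr => k _.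
  by rewrite mulrDl mulrA.
- rewrite rmorph_sum/=; apply: eq_bigr => k _.
  by rewrite rmorphM/= conjCK mulrC.
- by rewrite sumr_ge0// => k _; rewrite -normCK exprn_ge0.
Qed.

Lemma quad_partial_dotE n a :
  quad (partial_dot n) a = \sum_(k < n) normsq (a k).
Proof.
rewrite /quad /partial_dot (big_morph _ (@ReD R) (erefl : complex.Re 0 = 0)).
by apply: eq_bigr => k _; rewrite ReM Re_conj Im_conj /normsq; ring.
Qed.

Lemma quad_partial_dot_le a m n : (m <= n)%N ->
  quad (partial_dot m) a <= quad (partial_dot n) a.
Proof.
move=> mn; rewrite !quad_partial_dotE -(subnKC mn) big_split_ord/= lerDl.
by rewrite sumr_ge0// => k _; exact: normsq_ge0.
Qed.

Lemma normsq_le_quad_partial_dot a k :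
  normsq (a k) <= quad (partial_dot k.+1) a.
Proof.
rewrite quad_partial_dotE big_ord_recr/= lerDr.
by rewrite sumr_ge0// => i _; exact: normsq_ge0.
Qed.

(** Since the terms are nonnegative, bounded partial sums amount to convergence of the series. *)
Definition square_summable a : Prop :=
  exists M : R, forall n, quad (partial_dot n) a <= M.

Lemma square_summable_lin z a b :
  square_summable a -> square_summable b -> square_summable (z *: a + b).
Proof.
move=> [M Ma] [N Nb]; exists (2 * (normsq z * M) + 2 * N) => n.
rewrite (le_trans (quadD_le (partial_dot_positive n) _ _))//.
rewrite (quadZ (partial_dot_positive n)).
by rewrite lerD// ler_pM2l// ler_wpM2l ?normsq_ge0.
Qed.

Lemma square_summable0 : square_summable 0.
Proof.
exists 0 => n; rewrite quad_partial_dotE big1// => k _.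
by rewrite /normsq/= expr0n addr0.
Qed.

Definition complex_cvg (u : nat -> R[i]) (l : R[i]) : Prop :=
  (fun n => complex.Re (u n)) @ \oo --> complex.Re l /\
  (fun n => complex.Im (u n)) @ \oo --> complex.Im l.

Lemma complex_cvg_unique u l l' : complex_cvg u l -> complex_cvg u l' -> l = l'.
Proof.
move=> [h k] [h' k']; apply: complex_eq.
- exact: (cvg_unique (@norm_hausdorff _ R) h h').
- exact: (cvg_unique (@norm_hausdorff _ R) k k').
Qed.

Lemma complex_cvg_lin z u v l m : complex_cvg u l -> complex_cvg v m ->
  complex_cvg (fun n => z * u n + v n) (z * l + m).
Proof.
move=> [h k] [h' k']; split.
- rewrite ReD ReM; under eq_fun do rewrite ReD ReM.
  by apply: cvgD => //; apply: cvgB; apply: cvgM => //; exact: cvg_cst.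
- rewrite ImD ImM; under eq_fun do rewrite ImD ImM.
  by apply: cvgD => //; apply: cvgD; apply: cvgM => //; exact: cvg_cst.
Qed.

Lemma complex_cvg_conj u l : complex_cvg u l ->
  complex_cvg (fun n => Num.conj (u n)) (Num.conj l).
Proof.
move=> [h k]; split.
- by rewrite Re_conj; under eq_fun do rewrite Re_conj.
- by rewrite Im_conj; under eq_fun do rewrite Im_conj; exact: cvgN.
Qed.

(** The l2 inner product; its value is meaningful only when both real limits exist, as they do for
    square summable sequences. *)
Definition series_dot a b : R[i] :=
  Complex (limn (fun n => complex.Re (partial_dot n a b)))
          (limn (fun n => complex.Im (partial_dot n a b))).

Lemma is_cvg_quad_partial_dot a : square_summable a ->
  cvgn (fun n => quad (partial_dot n) a).
Proof.
move=> [M aM]; apply: nondecreasing_is_cvgn.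
  by move=> m n mn; exact: quad_partial_dot_le.
by exists M => _ [n _ <-].
Qed.

(** Polarisation: the real part is a combination of three nondecreasing bounded sequences. *)
Let is_cvg_Re_partial_dot a b : square_summable a -> square_summable b ->
  cvgn (fun n => complex.Re (partial_dot n a b)).
Proof.
move=> sa sb.
have sab : square_summable (a + b).
  by rewrite -(scale1r a); exact: square_summable_lin.
have -> : (fun n => complex.Re (partial_dot n a b)) =
    (fun n => 2^-1 * (quad (partial_dot n) (a + b)
      - quad (partial_dot n) a - quad (partial_dot n) b)).
  apply/funext => n; by rewrite (quadD (partial_dot_positive n)); lra.
apply: is_cvgM; first exact: is_cvg_cst.
by apply: is_cvgB; [apply: is_cvgB|]; exact: is_cvg_quad_partial_dot.
Qed.

Lemma cvg_partial_dot a b : square_summable a -> square_summable b ->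
  complex_cvg (fun n => partial_dot n a b) (series_dot a b).
Proof.
move=> sa sb; split; first exact: is_cvg_Re_partial_dot.
rewrite /series_dot/=.
have -> : (fun n => complex.Im (partial_dot n a b)) =
    (fun n => - complex.Re (partial_dot n ('i%C *: a) b)).
  apply/funext => n; rewrite Im_Re.
  by rewrite (positive_formZl (partial_dot_positive n)).
apply: is_cvgN; apply: is_cvg_Re_partial_dot => //.
by rewrite -(addr0 (_ *: a)); apply: square_summable_lin => //; exact: square_summable0.
Qed.

End SquareSummable.

(** A boolean predicate, so that [l2] is a subtype of the sequences and inherits their module
    structure. *)
Definition l2_pred (R : realType) : {pred nat -> R[i]} :=
  fun a => `[< square_summable a >].

Record l2 (R : realType) := L2 {
  l2_seq :> nat -> R[i];
  l2_summable : l2_seq \in @l2_pred R }.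

Section L2.
Context {R : realType}.

HB.instance Definition _ := [isSub for @l2_seq R].
HB.instance Definition _ := [Choice of l2 R by <:].

Lemma l2_submod_closed : submod_closed (@l2_pred R).
Proof.
split; first by apply/asboolP; exact: square_summable0.
move=> z a b /asboolP sa /asboolP sb; apply/asboolP.
exact: square_summable_lin.
Qed.

HB.instance Definition _ := GRing.isSubmodClosed.Build _ _ (@l2_pred R) l2_submod_closed.
HB.instance Definition _ := [SubChoice_isSubLmodule of l2 R by <:].

Lemma l2P (a : l2 R) : square_summable a.
Proof. exact/asboolP/(l2_summable a). Qed.

Definition l2_dot (a b : l2 R) : R[i] := series_dot a b.

Lemma cvg_l2_dot (a b : l2 R) :
  complex_cvg (fun n => partial_dot n a b) (l2_dot a b).
Proof. exact: cvg_partial_dot (l2P a) (l2P b). Qed.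

Lemma cvg_quad_l2_dot (a : l2 R) :
  (fun n => quad (partial_dot n) a) @ \oo --> quad l2_dot a.
Proof. by case: (cvg_l2_dot a a). Qed.

Lemma quad_partial_dot_le_l2 n (a : l2 R) : quad (partial_dot n) a <= quad l2_dot a.
Proof.
have -> : quad l2_dot a = limn (fun n => quad (partial_dot n) a).
  by apply/esym/cvg_lim => //; exact: cvg_quad_l2_dot.
apply: nondecreasing_cvgn_le.
  by move=> i j ij; exact: quad_partial_dot_le.
by apply/cvg_ex; exists (quad l2_dot a); exact: cvg_quad_l2_dot.
Qed.

Lemma quad_l2_dot_le (a : l2 R) (M : R) :
  (forall n, quad (partial_dot n) a <= M) -> quad l2_dot a <= M.
Proof.
move=> aM; have <- := cvg_lim (@norm_hausdorff _ R) (@cvg_quad_l2_dot a).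
apply: limr_le; last by apply: nearW => n; exact: aM.
by apply/cvg_ex; exists (quad l2_dot a); exact: cvg_quad_l2_dot.
Qed.

Lemma l2_dot_positive : positive_form l2_dot.
Proof.
split=> [z a b c|a b|a].
- apply: complex_cvg_unique (cvg_l2_dot _ _) _ => /=.
  have := complex_cvg_lin z (cvg_l2_dot a c) (cvg_l2_dot b c).
  congr complex_cvg; apply/funext => n /=.
  by case: (@partial_dot_positive R n) => h _ _; rewrite -h.
- apply: complex_cvg_unique (cvg_l2_dot _ _) _ => /=.
  have := complex_cvg_conj (cvg_l2_dot a b).
  congr complex_cvg; apply/funext => n /=.
  by rewrite -(positive_formC (partial_dot_positive n)).
- have [_ h] := cvg_l2_dot a a.
  rewrite lecE; apply/andP; split.
    apply/eqP; apply: (cvg_unique (@norm_hausdorff _ R) h).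
    rewrite (_ : (fun _ => _) = cst 0); first exact: cvg_cst.
    by apply/funext => n; rewrite (form_quadE (partial_dot_positive n)).
  apply: le_trans (quad_partial_dot_le_l2 0 a).
  by rewrite quad_partial_dotE big_ord0.
Qed.

Lemma l2_quad_eq0 (a : l2 R) : quad l2_dot a = 0 -> a = 0.
Proof.
move=> a0; apply/val_inj/funext => k /=; apply: normsq_eq0.
apply/eqP; rewrite eq_le normsq_ge0 andbT.
rewrite (le_trans (normsq_le_quad_partial_dot _ _))//.
by rewrite -a0 quad_partial_dot_le_l2.
Qed.

End L2.

(** * Norm, completeness, inner product and separability of l2 *)

Section L2Hilbert.
Context {R : realType}.
Implicit Types (a b : l2 R) (e : R).

Lemma gt0_complexE (e : R[i]) : 0 < e -> 0 < complex.Re e /\ e = (complex.Re e)%:C%C.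
Proof.
by move=> e0; have eE := RRe_real (gtr0_real e0); split=> //; rewrite -ltcR eE.
Qed.

Definition l2_norm a : R[i] := (Num.sqrt (quad l2_dot a))%:C%C.

Let l2_normD a b : l2_norm (a + b) <= l2_norm a + l2_norm b.
Proof. by rewrite -rmorphD/= lecR; exact: sqrt_quadD l2_dot_positive _ _. Qed.

Let l2_normZ (z : R[i]) a : l2_norm (z *: a) = `|z| * l2_norm a.
Proof.
rewrite /l2_norm (quadZ l2_dot_positive) sqrtrM ?normsq_ge0//.
by rewrite normsqE rmorphM.
Qed.

Let l2_norm_eq0 a : l2_norm a = 0 -> a = 0.
Proof.
move=> /complexI/eqP; rewrite sqrtr_eq0 => a0; apply: l2_quad_eq0.
by apply/eqP; rewrite eq_le a0 (quad_ge0 l2_dot_positive).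
Qed.

HB.instance Definition _ :=
  Lmodule_isNormed.Build R[i] (l2 R) l2_normD l2_normZ l2_norm_eq0.

Lemma l2_normE a : `|a| = (Num.sqrt (quad l2_dot a))%:C%C.
Proof. by []. Qed.

Lemma l2_norm_le a e : 0 <= e -> (`|a| <= e%:C%C) = (quad l2_dot a <= e ^+ 2).
Proof.
move=> e0; rewrite l2_normE lecR -[in RHS](ger0_norm e0) -sqrtr_sqr.
by rewrite sqr_sqrtr ?sqr_ge0// -{1}(ger0_norm e0) -sqrtr_sqr ler_sqrt ?sqr_ge0.
Qed.

(** A truncation involves finitely many coordinates, so coordinatewise limits pass through it; this
    is what allows a Cauchy bound to survive in the limit. *)
Lemma cvg_quad_partial_dot n (u : nat -> nat -> R[i]) (a : nat -> R[i]) :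
  (forall k, complex_cvg (u^~ k) (a k)) ->
  (fun m => quad (partial_dot n) (u m)) @ \oo --> quad (partial_dot n) a.
Proof.
move=> ua; elim: n => [|n IH].
  rewrite quad_partial_dotE big_ord0; under eq_fun do rewrite quad_partial_dotE big_ord0.
  exact: cvg_cst.
rewrite quad_partial_dotE big_ord_recr/= -quad_partial_dotE.
under eq_fun do rewrite quad_partial_dotE big_ord_recr/= -quad_partial_dotE.
have [h k] := ua n.
by apply: cvgD => //; apply: cvgD; apply: cvgM.
Qed.

Lemma complex_cauchy_cvg (u : nat -> R[i]) :
  (forall e : R, 0 < e -> exists N, forall m n, (N <= m)%N -> (N <= n)%N ->
    normsq (u m - u n) <= e) ->
  exists l, complex_cvg u l.
Proof.
move=> uC.
(* Covers the real and the imaginary part at once: both are 1-Lipschitz. *)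
have rC (f : R[i] -> R) :
    (forall z w, (f z - f w) ^+ 2 <= normsq (z - w)) -> cvgn (f \o u).
  move=> fle; apply: cauchy_cvg; apply: cauchy_exP => e e0.
  have [N NP] := uC ((e / 2) ^+ 2) (exprn_gt0 _ (divr_gt0 e0 (ltr0Sn _ 1))).
  exists (f (u N)); exists N => //= n /= Nn.
  rewrite -ball_normE/= (@le_lt_trans _ _ (e / 2))//; last lra.
  rewrite -(ler_pXn2r (_ : 0 < 2)%N) ?nnegrE//; last lra.
  by rewrite real_normK ?num_real// (le_trans (fle _ _))// NP.
have hR : cvgn (@complex.Re R \o u).
  by apply: rC => z w; rewrite /normsq ReB lerDl sqr_ge0.
have hI : cvgn (@complex.Im R \o u).
  by apply: rC => z w; rewrite /normsq ImD ImN lerDr sqr_ge0.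
by exists (Complex (limn (@complex.Re R \o u)) (limn (@complex.Im R \o u))).
Qed.

(** The limit [a] is taken coordinatewise. The Cauchy bound is first passed to the limit in each
    truncation, then extended to the whole series. *)
Lemma l2_cauchy_seq_cvg (p : nat -> l2 R) :
  (forall e, 0 < e -> exists N, forall m n, (N <= m)%N -> (N <= n)%N ->
    quad l2_dot (p m - p n) <= e) ->
  exists a, forall e, 0 < e -> exists N, forall n, (N <= n)%N ->
    quad l2_dot (p n - a) <= e.
Proof.
move=> pC.
have /choice[a aP] : forall k, exists l, complex_cvg (fun n => p n k) l.
  move=> k; apply: complex_cauchy_cvg => e /pC[N NP]; exists N => m n Nm Nn.
  apply: le_trans (NP m n Nm Nn).
  apply: le_trans (quad_partial_dot_le_l2 k.+1 _).
  exact: (normsq_le_quad_partial_dot (p m - p n) k).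
(* [N] does not depend on the truncation length [j]; this uniformity gives both the summability of
   [a] and convergence in norm. *)
have pa e : 0 < e -> exists N, forall n j, (N <= n)%N ->
    quad (partial_dot j) (l2_seq (p n) - a) <= e.
  move=> /pC[N NP]; exists N => n j Nn.
  have h : (fun m => quad (partial_dot j) (l2_seq (p n) - l2_seq (p m))) @ \oo -->
      quad (partial_dot j) (l2_seq (p n) - a).
    apply: cvg_quad_partial_dot => k.
    have c : complex_cvg (fun=> p n k) (p n k) by split; exact: cvg_cst.
    have := complex_cvg_lin (-1) (aP k) c.
    by congr complex_cvg; [apply/funext => m|]; rewrite mulN1r addrC.
  rewrite -(cvg_lim (@norm_hausdorff _ R) h); apply: limr_le; first exact: cvgP h.
  exists N => //= m Nm; apply: le_trans (NP n m Nn Nm).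
  exact: (quad_partial_dot_le_l2 j (p n - p m)).
have sa : square_summable a.
  have [N NP] := pa 1 ltr01.
  have -> : a = -1 *: (l2_seq (p N) - a) + l2_seq (p N).
    by rewrite scaleN1r opprB subrK.
  by apply: square_summable_lin (l2P _); exists 1 => j; exact: NP.
have sa' : a \in @l2_pred R by apply/asboolP.
exists (L2 sa') => e /pa[N NP]; exists N => n Nn.
by apply: quad_l2_dot_le => j; exact: NP.
Qed.

Lemma invS_le_eventually e : 0 < e ->
  exists N, forall n, (N <= n)%N -> n.+1%:R^-1 <= e.
Proof.
move=> e0; have [N _ NP] := near_infty_natSinv_lt (PosNum e0).
by exists N => n Nn; exact: ltW (NP n Nn).
Qed.

(** A Cauchy filter contains balls of radius 1/(n+1). Their centres form a Cauchy sequence, and the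
    filter converges to its limit. *)
Lemma l2_complete (F : set_system (l2 R)) : ProperFilter F -> cauchy F -> cvg F.
Proof.
move=> FF /cauchyP FC.
have /choice[p pP] : forall n : nat, exists x, F (ball x (n.+1%:R^-1%:C%C : R[i])).
  by move=> n; apply: FC; rewrite ltcR invr_gt0.
have [a aP] : exists a, forall e, 0 < e -> exists N, forall n, (N <= n)%N ->
    quad l2_dot (p n - a) <= e.
  apply: l2_cauchy_seq_cvg => e e0.
  have e2 : 0 < Num.sqrt e / 2 by rewrite divr_gt0 ?sqrtr_gt0.
  have [N NE] := invS_le_eventually e2; exists N => m n Nm Nn.
  (* Two members of a proper filter meet, so the two centres are joined through a common point
     [y]. *)
  have [y [ym yn]] := filter_ex (filterI (pP m) (pP n)).
  rewrite -(sqr_sqrtr (ltW e0)) -l2_norm_le ?sqrtr_ge0//.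
  rewrite -(subrK y (p m)) -addrA (le_trans (ler_normD _ _))//.
  have -> : Num.sqrt e = Num.sqrt e / 2 + Num.sqrt e / 2 by lra.
  rewrite rmorphD/= lerD//.
    move: ym; rewrite -ball_normE/= => /ltW/le_trans; apply.
    by rewrite lecR NE.
  move: yn; rewrite -ball_normE/= distrC => /ltW/le_trans; apply.
  by rewrite lecR NE.
apply/cvg_ex; exists a; apply/cvgrPdist_le => /= eps /gt0_complexE[e0 epsE].
rewrite {}epsE; move: (complex.Re eps) e0 => {eps} e e0.
have [N NP] := aP ((e / 2) ^+ 2) (exprn_gt0 _ (divr_gt0 e0 (ltr0Sn _ 1))).
have [M MP] := invS_le_eventually (divr_gt0 e0 (ltr0Sn _ 1)).
(* [N] brings the centre [p n] close to [a], and [M] makes the ball around it small. *)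
pose n := maxn M N.
near=> y.
rewrite -(subrK (p n) a) -addrA (le_trans (ler_normD _ _))//.
have -> : e = e / 2 + e / 2 by lra.
rewrite rmorphD/= lerD//.
  rewrite distrC l2_norm_le; last lra.
  by apply: NP; rewrite leq_maxr.
apply/ltW/(@lt_le_trans _ _ (n.+1%:R^-1%:C%C)).
  by near: y; have := pP n; rewrite -ball_normE.
by rewrite lecR MP// leq_maxl.
Unshelve. all: by end_near. Qed.

HB.instance Definition _ := Uniform_isComplete.Build (l2 R) l2_complete.

Lemma l2_dot_bilinear : bilinear_for *%R (Num.conj \; *%R) (@l2_dot R).
Proof.
split=> [c z a b|c z a b] /=.
- by rewrite (positive_formDl l2_dot_positive) (positive_formZl l2_dot_positive).
- by rewrite (positive_formDr l2_dot_positive) (positive_formZr l2_dot_positive).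
Qed.

HB.instance Definition _ := bilinear_isBilinear.Build R[i] (l2 R) (l2 R) R[i]
  *%R (Num.conj \; *%R) (@l2_dot R) l2_dot_bilinear.

Lemma l2_dot_hermitian a b : l2_dot a b = (-1) ^+ false * Num.conj (l2_dot b a).
Proof. by rewrite mul1r; exact: positive_formC l2_dot_positive _ _. Qed.

HB.instance Definition _ := isHermitianSesquilinear.Build R[i] (l2 R) false
  Num.conj (@l2_dot R) l2_dot_hermitian.

Lemma l2_dot_gt0 a : a != 0 -> 0 < l2_dot a a.
Proof.
move=> a0; rewrite (form_quadE l2_dot_positive) ltcR lt_def.
rewrite (quad_ge0 l2_dot_positive) andbT.
by apply: contra_neq a0; exact: l2_quad_eq0.
Qed.

HB.instance Definition _ := isDotProduct.Build R[i] (l2 R) (@l2_dot R) l2_dot_gt0.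

Lemma l2_dot_norm a : l2_dot a a = `|a| ^+ 2.
Proof.
rewrite (form_quadE l2_dot_positive) l2_normE -rmorphXn/=.
by rewrite sqr_sqrtr// (quad_ge0 l2_dot_positive).
Qed.

(** A finite list, continued by zeros, encodes a finitely supported sequence with rational
    coordinates; countability is then that of lists. *)
Let rational_point (s : seq (rat * rat)) (k : nat) : R[i] :=
  Complex (ratr (nth (0, 0) s k).1) (ratr (nth (0, 0) s k).2).

Let rational_point_default (s : seq (rat * rat)) k :
  (size s <= k)%N -> rational_point s k = 0.
Proof.
by move=> sk; rewrite /rational_point nth_default//= rmorph0.
Qed.

Let rational_point_summable s : rational_point s \in @l2_pred R.
Proof.
apply/asboolP; exists (quad (partial_dot (size s)) (rational_point s)) => n.
have [ns|/ltnW sn] := leqP n (size s); first exact: quad_partial_dot_le.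
rewrite -(subnKC sn) quad_partial_dotE big_split_ord/= -quad_partial_dotE.
rewrite [X in _ + X]big1 ?addr0// => i _.
by rewrite rational_point_default ?leq_addr// /normsq/= expr0n addr0.
Qed.

Let rational_approx (z : R[i]) e : 0 < e ->
  exists q : rat * rat, normsq (z - Complex (ratr q.1) (ratr q.2)) <= e.
Proof.
(* The minimum with 1 makes the square of [d] at most [e / 2]. *)
move=> e0; pose d := Num.min 1 (e / 2).
have d0 : 0 < d by rewrite lt_min ltr01/=; lra.
have dd : d ^+ 2 <= e / 2.
  rewrite expr2 -[leRHS]mul1r ler_pM ?(ltW d0)// ge_min ?lexx ?orbT//.
have approx (r : R) : exists q : rat, (r - ratr q) ^+ 2 <= e / 2.
  have [q] := @rat_in_itvoo R (r - d) (r + d) ltac:(lra).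
  rewrite in_itv/= => /andP[rq qr]; exists q; apply: le_trans dd.
  rewrite -real_normK ?num_real// ler_pXn2r ?nnegrE ?(ltW d0)//.
  by rewrite ler_norml; apply/andP; split; lra.
have [q1 h1] := approx (complex.Re z); have [q2 h2] := approx (complex.Im z).
exists (q1, q2) => /=; rewrite /normsq ReB ImD ImN/=; lra.
Qed.

(** A point [a] is cut at an index [N] beyond which its mass is at most [e / 2], and its first [N]
    coordinates are replaced by rational ones at a total cost of [e / 2]. *)
Lemma l2_separable : separable_space (l2 R).
Proof.
pose S := range (fun s => L2 (rational_point_summable s)).
exists S.
  exact: card_le_trans (card_image_le _ _) (countableP _).
move=> O [a Oa] openO.
have [e e0 eO] : exists2 e : R, 0 < e & forall b, quad l2_dot (a - b) <= e -> O b.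
  have : nbhs a O by exact: open_nbhs_nbhs.
  move=> /nbhs_ballP[eps /= /gt0_complexE[e0 epsE]] epsO.
  exists ((complex.Re eps / 2) ^+ 2); first by rewrite exprn_gt0// divr_gt0.
  move=> b; rewrite -l2_norm_le; last lra.
  move=> ab; apply: epsO; rewrite epsE -ball_normE/=.
  by apply: le_lt_trans ab _; rewrite ltcR; lra.
have [N NP] : exists N, quad l2_dot a - e / 2 <= quad (partial_dot N) a.
  have /cvgrPdist_le/(_ (e / 2))[|N _ NP] := @cvg_quad_l2_dot R a; first lra.
  exists N; have := NP N (leqnn N).
  by move=> /(le_trans (ler_norm _)) /=; lra.
(* Division by [N.+1] rather than [N] keeps the tolerance positive when [N] is 0. *)
have d0 : 0 < e / 2 / N.+1%:R by rewrite !divr_gt0.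
have /choice[q qP] := fun k => rational_approx (a k) d0.
pose s := mkseq q N.
exists (L2 (rational_point_summable s)); split; last by exists s.
apply: eO; apply: quad_l2_dot_le => n.
(* A longer truncation of length [N + n] can be split exactly at [N]. *)
apply: le_trans (quad_partial_dot_le _ (leq_addl N n)) _.
rewrite quad_partial_dotE big_split_ord/=.
have h1 : \sum_(i < N) normsq (a i - rational_point s i) <= e / 2.
  apply: (@le_trans _ _ (\sum_(i < N) e / 2 / N.+1%:R)).
    apply: ler_sum => i _; rewrite /rational_point nth_mkseq//; exact: qP.
  rewrite sumr_const card_ord -[_ *+ N]mulr_natr (mulrAC (e / 2)) ler_pdivrMr ?ltr0n//.
  by rewrite ler_wpM2l ?ler_nat//; lra.
have h2 : \sum_(i < n) normsq (a (N + i)%N - rational_point s (N + i)%N) <= e / 2.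
  under eq_bigr => i _ do
    rewrite rational_point_default ?subr0 ?size_mkseq ?leq_addr//.
  have := quad_partial_dot_le_l2 (N + n) a.
  rewrite quad_partial_dotE big_split_ord/= -quad_partial_dotE; lra.
lra.
Qed.

HB.instance Definition _ := CompleteNormedModule_isHilbert.Build R (l2 R)
  l2_dot_norm l2_separable.

End L2Hilbert.

(** * Bounded operators and adjoints *)

Section HilbertSpaces.
Context {R : realType}.
Implicit Types H K : hilbertType R.

Lemma dotp_positive H : positive_form (@dotp R H).
Proof.
split=> [a x y z|x y|x].
- by rewrite linearPl.
- by rewrite hermC mul1r.
- exact: dnorm_ge0.
Qed.

Lemma normE H (x : H) : `|x| = (hnorm x)%:C%C.
Proof. by rewrite /hnorm RRe_real// ger0_real. Qed.

Lemma hnorm_ge0 H (x : H) : 0 <= hnorm x.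
Proof. by rewrite -ler0c -normE. Qed.

Lemma quad_dotp H (x : H) : quad dotp x = hnorm x ^+ 2.
Proof. by rewrite /quad dotp_norm normE -rmorphXn. Qed.

Lemma hnormD_le H (x y : H) : hnorm (x + y) <= hnorm x + hnorm y.
Proof. by rewrite -lecR rmorphD/= -!normE; exact: ler_normD. Qed.

Lemma hnorm0 H : hnorm (0 : H) = 0.
Proof. by rewrite /hnorm normr0. Qed.

Lemma hnormN H (x : H) : hnorm (- x) = hnorm x.
Proof. by rewrite /hnorm normrN. Qed.

Lemma hnormZr H (r : R) (x : H) : 0 <= r -> hnorm (r%:C%C *: x) = r * hnorm x.
Proof.
by move=> r0; apply: complexI; rewrite -normE normrZ normE rmorphM/= ger0_norm ?ler0c.
Qed.

Lemma hnorm_eq0 H (x : H) : hnorm x = 0 -> x = 0.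
Proof. by move=> x0; apply/eqP; rewrite -normr_eq0 normE x0. Qed.

Lemma Re_dotp_le H (x y : H) : complex.Re (dotp x y) <= hnorm x * hnorm y.
Proof.
have := Re_form_le (dotp_positive H) x y.
by rewrite !quad_dotp !sqrtr_sqr !ger0_norm ?hnorm_ge0.
Qed.

Lemma dotp_ext H (x y : H) : (forall z, dotp z x = dotp z y) -> x = y.
Proof.
move=> xy; apply/eqP; rewrite -subr_eq0; apply/eqP/hnorm_eq0/eqP.
rewrite -sqrf_eq0 -quad_dotp /quad (positive_formDr (dotp_positive H)) xy.
by rewrite -(positive_formDr (dotp_positive H)) subrr linear0r.
Qed.

Lemma hnorm_le_of_dotp H (x : H) (c : R) : 0 <= c ->
  complex.Re (dotp x x) <= c * hnorm x -> hnorm x <= c.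
Proof.
move=> c0; rewrite -[complex.Re _]/(quad _ _) quad_dotp expr2.
have := hnorm_ge0 x; rewrite le_eqVlt => /predU1P[<-//|x0].
by rewrite ler_pM2r.
Qed.

Lemma hilbert_cauchy_cvg H (u : nat -> H) :
  (forall e : R, 0 < e -> exists N, forall m n, (N <= m)%N -> (N <= n)%N ->
    hnorm (u m - u n) <= e) ->
  exists l, forall e : R, 0 < e -> exists N, forall n, (N <= n)%N ->
    hnorm (u n - l) <= e.
Proof.
move=> uC.
have : cvgn u.
  apply: cauchy_cvg; apply: cauchy_exP => eps /= /gt0_complexE[e0 epsE].
  have [N NP] := uC _ (divr_gt0 e0 (ltr0Sn _ 1)).
  exists (u N); exists N => //= n /= Nn.
  rewrite epsE -ball_normE/= normE ltcR.
  by apply: le_lt_trans (NP N n (leqnn _) Nn) _; lra.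
move=> /cvg_ex[l /cvgrPdist_le ul]; exists l => e e0.
have [|N _ NP] := ul (e%:C%C); first by rewrite ltcR.
by exists N => n /NP/=; rewrite distrC normE lecR.
Qed.

Section Linear.
Context {V W : lmodType R[i]} (f : V -> W) (flin : linear f).

Lemma linear_apD x y : f (x + y) = f x + f y.
Proof. by have := flin 1 x y; rewrite !scale1r. Qed.

Lemma linear_ap0 : f 0 = 0.
Proof. by apply: (addrI (f 0)); rewrite -linear_apD !addr0. Qed.

Lemma linear_apZ a x : f (a *: x) = a *: f x.
Proof. by have := flin a x 0; rewrite linear_ap0 !addr0. Qed.

Lemma linear_apB x y : f (x - y) = f x - f y.
Proof. by rewrite linear_apD -scaleN1r linear_apZ scaleN1r. Qed.

End Linear.

(* Minimise |x|^2 - 2 Re (phi x); by the parallelogram law a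
   minimising sequence is Cauchy, and its limit represents phi. *)
Lemma Riesz_representation H (phi : H -> R[i]) (M : R) :
  (forall a x y, phi (a *: x + y) = a * phi x + phi y) ->
  (forall x, complex.Re (phi x) <= M * hnorm x) ->
  exists x, forall y, phi y = dotp y x.
Proof.
move=> philin phiM.
have phiD x y : phi (x + y) = phi x + phi y.
  by have := philin 1 x y; rewrite scale1r mul1r.
have phi0 : phi 0 = 0 by apply: (addrI (phi 0)); rewrite -phiD !addr0.
have phiZ a x : phi (a *: x) = a * phi x.
  by have := philin a x 0; rewrite phi0 !addr0.
pose q x := hnorm x ^+ 2 - 2 * complex.Re (phi x).
have hq : has_inf (range q).
  split; first by exists (q 0); exists 0.
  (* Completing the square in |x|^2 - 2 M |x|. *)
  exists (- M ^+ 2) => _ [x _ <-]; rewrite /q.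
  by have := phiM x; have := sqr_ge0 (hnorm x - M); rewrite sqrrB; lra.
pose m := inf (range q).
have mq x : m <= q x by apply: ge_inf; [case: hq|exists x].
have /choice[u uP] : forall n : nat, exists x, q x < m + n.+1%:R^-1.
  move=> n; have n0 : 0 < n.+1%:R^-1 :> R by rewrite invr_gt0.
  by have [_ [x _ <-] qx] := inf_adherent n0 hq; exists x.
(* The parallelogram law in terms of [q]: the linear parts cancel. *)
have quad_mid x y :
    hnorm (x - y) ^+ 2 = 2 * q x + 2 * q y - 4 * q ((2^-1)%:C%C *: (x + y)).
  rewrite /q phiZ phiD -!quad_dotp (quadZ (dotp_positive H)) (quadB (dotp_positive H)).
  by rewrite (quadD (dotp_positive H)) ReM ReD/= /normsq/=; lra.
have [x xP] : exists l, forall e : R, 0 < e -> exists N, forall n, (N <= n)%N ->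
    hnorm (u n - l) <= e.
  apply: hilbert_cauchy_cvg => e e0.
  (* Two values of [q] within [e ^+ 2 / 4] of the infimum force a squared distance of at most
     [e ^+ 2], by [quad_mid]. *)
  have [N NP] := @invS_le_eventually R (e ^+ 2 / 4) ltac:(by rewrite divr_gt0 ?exprn_gt0).
  exists N => i j Ni Nj.
  rewrite -(ler_pXn2r (_ : 0 < 2)%N) ?nnegrE ?hnorm_ge0 ?(ltW e0)// quad_mid.
  have := mq ((2^-1)%:C%C *: (u i + u j)).
  have qle k : (N <= k)%N -> q (u k) <= m + e ^+ 2 / 4.
    by move=> Nk; apply: le_trans (ltW (uP k)) _; rewrite lerD2l NP.
  have := qle i Ni; have := qle j Nj.
  move: (q (u i)) (q (u j)) (q _) (e ^+ 2) => qi qj qij e2; lra.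
have Re_eq y : complex.Re (dotp y x) = complex.Re (phi y).
  apply/eqP; rewrite -subr_eq0; apply/negP => /negP.
  set c := _ - _ => c0.
  pose Q := hnorm y ^+ 2; have Q0 : 0 <= Q by exact: sqr_ge0.
  (* Moving the minimiser by t y would change [q] by t^2 Q + 2 t c. This t makes the change at most
     - c^2 / (Q + 1), contradicting minimality; the added 1 allows for Q = 0. *)
  pose t : R := - c / (Q + 1).
  have step n : - n.+1%:R^-1 <=
      t ^+ 2 * Q + 2 * t * (complex.Re (dotp y (u n)) - complex.Re (phi y)).
    have := mq (t%:C%C *: y + u n); have := uP n.
    rewrite /q phiD phiZ -!quad_dotp (quadD (dotp_positive H)) (quadZ (dotp_positive H)).
    rewrite ReD (positive_formZl (dotp_positive H)) !ReM/= /normsq/= (quad_dotp y) -/Q.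
    by move: n.+1%:R^-1 => d; lra.
  have eps0 : 0 < c ^+ 2 / (Q + 1) by rewrite divr_gt0 ?exprn_even_gt0//; lra.
  have tE : t ^+ 2 * Q + 2 * t * c <= - (c ^+ 2 / (Q + 1)).
    have -> : t ^+ 2 * Q + 2 * t * c =
       - (c ^+ 2 / (Q + 1)) - c ^+ 2 / (Q + 1) ^+ 2.
      by rewrite /t; field; rewrite gt_eqF// ltr_wpDl.
    by rewrite gerBl divr_ge0 ?sqr_ge0.
  pose eps : R := c ^+ 2 / (Q + 1); rewrite -/eps in eps0 tE.
  have [N1 P1] := @invS_le_eventually R (eps / 4) ltac:(lra).
  (* Tolerance on |u n - x| under which replacing [x] by [u n] costs at most [eps / 4]; the added 1
     keeps the denominator positive. *)
  have b0 : 0 < eps / 4 / (2 * `|t| * hnorm y + 1).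
    apply: divr_gt0; first exact: divr_gt0.
    apply: ltr_wpDl => //; apply: mulr_ge0; last exact: hnorm_ge0.
    exact: mulr_ge0.
  have [N2 P2] := xP _ b0.
  pose n := maxn N1 N2.
  have := step n; have := P1 n (leq_maxl _ _); have := P2 n (leq_maxr _ _).
  rewrite ler_pdivlMr ?ltr_wpDl ?mulr_ge0 ?hnorm_ge0// => h2 h1 h3.
  have h4 : 2 * t * (complex.Re (dotp y (u n)) - complex.Re (dotp y x)) <= eps / 4.
    apply: le_trans h2.
    rewrite -ReB -(positive_formNr (dotp_positive H)) -(positive_formDr (dotp_positive H)).
    apply: (@le_trans _ _ (2 * `|t| * (hnorm y * hnorm (u n - x)))); last first.
      by have := hnorm_ge0 (u n - x); lra.
    rewrite -mulrA -[leRHS]mulrA ler_pM2l// (le_trans (ler_norm _))// normrM.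
    apply: ler_wpM2l => //; rewrite ler_norml lerNl -ReN.
    rewrite -(positive_formNl (dotp_positive H)) Re_dotp_le andbT.
    by apply: le_trans (Re_dotp_le _ _) _; rewrite hnormN.
  have := le_trans (_ : - (eps / 4) <= - n.+1%:R^-1) h3; rewrite lerN2 => /(_ h1).
  by move: h4 tE eps0; rewrite /c; clearbody eps t Q; lra.
exists x => y; apply: complex_eq; first by rewrite Re_eq.
(* Imaginary parts agree because real parts agree at i y. *)
by rewrite !Im_Re -phiZ -(positive_formZl (dotp_positive H)) Re_eq.
Qed.

Definition bounded_linear H K (f : H -> K) : Prop :=
  linear f /\ exists2 M : R, 0 <= M & forall x, hnorm (f x) <= M * hnorm x.

Lemma bounded_op_linear H K (f : H -> K) : bounded_op f -> bounded_linear f.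
Proof.
move=> [flin fb]; split=> //.
pose g : {linear H -> K} := HB.pack f (GRing.isLinear.Build _ _ _ _ f flin).
have /linear_boundedP/pinfty_ex_gt0[M /gt0_complexE[M0 ->] gM] :
  bounded_near g (nbhs (0 : H)) by [].
exists (complex.Re M); first exact: ltW.
by move=> x; have := gM x; rewrite !normE -rmorphM/= lecR.
Qed.

Lemma isometric_hnorm H K (f : H -> K) x : isometric f -> hnorm (f x) = hnorm x.
Proof. by move=> [_ fx]; rewrite /hnorm fx. Qed.

Lemma isometric_bounded H K (f : H -> K) : isometric f -> bounded_linear f.
Proof.
move=> fi; split; first by case: fi.
by exists 1 => // x; rewrite isometric_hnorm// mul1r.
Qed.

Lemma bounded_linear_comp H K (L : hilbertType R) (f : K -> L) (g : H -> K) :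
  bounded_linear f -> bounded_linear g -> bounded_linear (f \o g).
Proof.
move=> [flin [M M0 fM]] [glin [N N0 gN]]; split=> [a x y|] /=.
  by rewrite glin flin.
exists (M * N); first exact: mulr_ge0.
move=> x /=; apply: le_trans (fM _) _; rewrite -mulrA.
by rewrite ler_wpM2l.
Qed.

Lemma bounded_linear_sub H K (f g : H -> K) :
  bounded_linear f -> bounded_linear g -> bounded_linear (f \- g).
Proof.
move=> [flin [M M0 fM]] [glin [N N0 gN]]; split=> [a x y|] /=.
  by rewrite glin flin scalerBr opprD addrACA.
exists (M + N); first exact: addr_ge0.
move=> x /=; apply: le_trans (hnormD_le _ _) _; rewrite mulrDl lerD//.
by rewrite hnormN.
Qed.

Lemma bounded_linear_id H : bounded_linear (idfun : H -> H).
Proof. by split=> //; exists 1 => // x; rewrite mul1r. Qed.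

Lemma opnorm_le H K (f : H -> K) (c : R) : 0 <= c ->
  (forall x, hnorm (f x) <= c * hnorm x) -> opnorm f <= c.
Proof.
move=> c0 fc; apply: ge_sup.
  by exists (hnorm (f 0)); exists 0 => //=; rewrite hnorm0.
move=> _ [x /= x1 <-]; apply: le_trans (fc x) _.
by rewrite -[leRHS]mulr1 ler_wpM2l.
Qed.

(** Scaling to a unit vector; boundedness of [f] ensures that [opnorm f] is a genuine supremum. *)
Lemma le_opnorm H K (f : H -> K) x : bounded_linear f ->
  hnorm (f x) <= opnorm f * hnorm x.
Proof.
move=> [flin [M M0 fM]].
have ub : has_ubound [set hnorm (f x) | x in [set x : H | hnorm x <= 1]].
  exists M => _ [y /= y1 <-]; apply: le_trans (fM y) _.
  by rewrite -[leRHS]mulr1 ler_wpM2l.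
have := hnorm_ge0 x; rewrite le_eqVlt => /predU1P[x0|x0].
  by rewrite (hnorm_eq0 (esym x0)) linear_ap0// !hnorm0 mulr0.
rewrite -ler_pdivrMr// mulrC -hnormZr ?invr_ge0 ?(ltW x0)// -linear_apZ//.
apply: ub_le_sup => //; eexists => //=.
by rewrite hnormZr ?invr_ge0 ?(ltW x0)// mulVf ?gt_eqF.
Qed.

Lemma opnorm_ge0 H K (f : H -> K) : bounded_linear f -> 0 <= opnorm f.
Proof.
move=> [flin [M M0 fM]]; apply: ub_le_sup => /=.
  exists M => _ [y /= y1 <-]; apply: le_trans (fM y) _.
  by rewrite -[leRHS]mulr1 ler_wpM2l.
by exists 0 => /=; rewrite ?linear_ap0// hnorm0.
Qed.

Lemma le_of_opnorm H K (f : H -> K) (c : R) x : bounded_linear f ->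
  opnorm f <= c -> hnorm (f x) <= c * hnorm x.
Proof.
by move=> fb fc; apply: le_trans (le_opnorm x fb) _; rewrite ler_wpM2r ?hnorm_ge0.
Qed.

(** Riesz representation of x -> <f x, y> shows that the set defining [adjoint f] is inhabited, so
    [xget] does not return its default value. *)
Lemma adjointP H K (f : H -> K) : bounded_linear f ->
  forall x y, dotp (f x) y = dotp x (adjoint f y).
Proof.
move=> [flin [M M0 fM]].
have /choice[g gP] : forall y, exists z, forall x, dotp (f x) y = dotp x z.
  move=> y; apply: (@Riesz_representation _ _ (M * hnorm y)).
    by move=> a x z; rewrite flin linearPl.
  move=> x; apply: le_trans (Re_dotp_le _ _) _.
  by rewrite mulrAC ler_wpM2r ?hnorm_ge0.
pose P := [set g : K -> H | forall x y, dotp (f x) y = dotp x (g y)].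
have : P (adjoint f) by apply: (@xgetPex _ _ P); exists g => x y; exact: gP.
by [].
Qed.

Lemma adjointPl H K (f : H -> K) : bounded_linear f ->
  forall x y, dotp (adjoint f y) x = dotp y (f x).
Proof.
move=> fb x y; rewrite (positive_formC (dotp_positive H) x) -(adjointP fb).
by rewrite -(positive_formC (dotp_positive K)).
Qed.

(** |f^* y|^2 = <f f^* y, y> is at most c |f^* y| |y|, and one factor |f^* y| cancels. *)
Lemma adjoint_le H K (f : H -> K) (c : R) y : bounded_linear f -> 0 <= c ->
  (forall x, hnorm (f x) <= c * hnorm x) -> hnorm (adjoint f y) <= c * hnorm y.
Proof.
move=> fb c0 fc; apply: hnorm_le_of_dotp; first by rewrite mulr_ge0 ?hnorm_ge0.
rewrite -adjointP//; apply: le_trans (Re_dotp_le _ _) _.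
by rewrite mulrAC ler_wpM2r ?hnorm_ge0.
Qed.

Lemma adjoint_bounded H K (f : H -> K) : bounded_linear f -> bounded_linear (adjoint f).
Proof.
move=> fb; split=> [a x y|].
  apply: dotp_ext => z; rewrite -adjointP//.
  rewrite !(positive_formDr (dotp_positive _)) !(positive_formZr (dotp_positive _)).
  by rewrite -!(adjointP fb).
by have [_ [M M0 fM]] := fb; exists M => // y; exact: adjoint_le.
Qed.

Lemma adjoint_unique H K (f : H -> K) (g : K -> H) : bounded_linear f ->
  (forall x y, dotp (f x) y = dotp x (g y)) -> adjoint f = g.
Proof.
by move=> fb fg; apply/funext => y; apply: dotp_ext => z; rewrite -adjointP.
Qed.

End HilbertSpaces.

(** * A common dilation *)

Section Dilation.
Context {R : realType}.
Implicit Types H K : hilbertType R.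

Lemma separable_dense_seq H : exists s : nat -> H,
  forall x (e : R), 0 < e -> exists k, hnorm (x - s k) <= e.
Proof.
have [S /countable_injP[f finj] dS] := @hilbert_separable R H.
exists (fun n => xget 0 [set x | S x /\ f x = n]) => x e e0.
have eC0 : 0 < e%:C%C :> R[i] by rewrite ltcR.
have [|y [/= xy Sy]] := dS (ball x e%:C%C) _ (ball_open _ _).
  by exists x; exact: ballxx.
exists (f y); case: xgetP => [z _ [Sz fzy]|/(_ y)]; last by case.
rewrite (finj _ _ _ _ fzy) ?inE// -lecR -normE.
by move: xy; rewrite -ball_normE/= => /ltW.
Qed.

(** Coefficients along a dense sequence; domination by the norm turns density in [H] into density
    for [B], so Parseval applies. It serves both to embed H_oo ([B] the inner product) and to obtain
    the defect maps. *)
Lemma l2_embedding H (B : H -> H -> R[i]) : positive_form B ->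
  (forall x, quad B x <= hnorm x ^+ 2) ->
  exists2 V : H -> l2 R, linear V & forall x, quad l2_dot (V x) = quad B x.
Proof.
move=> Bpos Ble; have [s sP] := separable_dense_seq H.
have Bs x (e : R) : 0 < e -> exists k, quad B (x - s k) <= e.
  move=> e0; have [|k kP] := sP x (Num.sqrt e); first by rewrite sqrtr_gt0.
  exists k; apply: le_trans (Ble _) _.
  by rewrite -(sqr_sqrtr (ltW e0)) ler_pXn2r ?nnegrE ?hnorm_ge0 ?sqrtr_ge0.
have sumV x : (fun k => coefficient B s k x) \in @l2_pred R.
  apply/asboolP; exists (quad B x) => n.
  by rewrite quad_partial_dotE sum_normsq_coefficient// gerBl quad_ge0.
exists (fun x => L2 (sumV x)) => [a x y|x].
  by apply/val_inj/funext => k; exact: coefficient_linear.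
apply: (cvg_unique (@norm_hausdorff _ R) (@cvg_quad_l2_dot R _)).
rewrite (_ : (fun _ => _) = fun n => \sum_(k < n) normsq (coefficient B s k x)).
  by apply: coefficient_Parseval => // e; exact: Bs.
by apply/funext => n; rewrite quad_partial_dotE.
Qed.

(** Realises the orthogonal sum of two copies of l2 inside l2 itself, on even and odd indices. *)
Definition interleave_seq (a b : nat -> R[i]) (k : nat) : R[i] :=
  if odd k then b k./2 else a k./2.

Lemma quad_interleave_seq a b n :
  quad (partial_dot n.*2) (interleave_seq a b) =
  quad (partial_dot n) a + quad (partial_dot n) b.
Proof.
rewrite !quad_partial_dotE; elim: n => [|n IH]; first by rewrite !big_ord0 addr0.
rewrite doubleS !big_ord_recr/= IH /interleave_seq/= odd_double/= doubleK.
by rewrite uphalf_double; ring.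
Qed.

Lemma interleave_summable (a b : l2 R) : interleave_seq a b \in @l2_pred R.
Proof.
apply/asboolP; exists (quad l2_dot a + quad l2_dot b) => n.
apply: le_trans (quad_partial_dot_le _ (_ : n <= n.*2)%N) _.
  by rewrite -addnn leq_addr.
by rewrite quad_interleave_seq lerD// quad_partial_dot_le_l2.
Qed.

Definition interleave a b := L2 (interleave_summable a b).

Lemma interleave_lin z a b c d :
  interleave (z *: a + b) (z *: c + d) = z *: interleave a c + interleave b d.
Proof.
apply/val_inj/funext => k.
rewrite -[RHS]/(z * interleave_seq a c k + interleave_seq b d k)/=.
by rewrite /interleave_seq; case: (odd k).
Qed.

Lemma quad_interleave a b :
  quad l2_dot (interleave a b) = quad l2_dot a + quad l2_dot b.
Proof.
apply/eqP; rewrite eq_le; apply/andP; split.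
  apply: quad_l2_dot_le => n.
  apply: le_trans (quad_partial_dot_le _ (_ : n <= n.*2)%N) _.
    by rewrite -addnn leq_addr.
  by rewrite quad_interleave_seq lerD// quad_partial_dot_le_l2.
have h : (fun n => quad (partial_dot n) a + quad (partial_dot n) b) @ \oo -->
    quad l2_dot a + quad l2_dot b by apply: cvgD; exact: cvg_quad_l2_dot.
rewrite -(cvg_lim (@norm_hausdorff _ R) h); apply: limr_le; first exact: (cvgP _ h).
apply: nearW => n /=; rewrite -quad_interleave_seq.
exact: (quad_partial_dot_le_l2 n.*2 (interleave a b)).
Qed.

(** The form of 1 - J^* J, written without the adjoint. *)
Definition defect_form H K (J : H -> K) (x y : H) : R[i] :=
  dotp x y - dotp (J x) (J y).

Lemma defect_form_positive H K (J : H -> K) : linear J ->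
  (forall x, hnorm (J x) <= hnorm x) -> positive_form (defect_form J).
Proof.
move=> Jlin Jle; rewrite /defect_form; split=> [a x y z|x y|x].
- by rewrite Jlin !linearPl/=; ring.
- rewrite (positive_formC (dotp_positive H) x) rmorphB/=.
  by rewrite (positive_formC (dotp_positive K) (J x)).
- rewrite !dotp_norm subr_ge0 ler_pXn2r ?nnegrE// !normE lecR; exact: Jle.
Qed.

Lemma quad_defect_form H K (J : H -> K) x :
  quad (defect_form J) x = hnorm x ^+ 2 - hnorm (J x) ^+ 2.
Proof. by rewrite /quad /defect_form ReB -!quad_dotp. Qed.

(** The space is l2 for all n at once, since every defect map lands in the same odd coordinates,
    while [U] embeds H_oo in the even ones. *)
Lemma common_dilation (H : nat -> hilbertType R) (Hoo : hilbertType R)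
    (J : forall n, H n -> Hoo) :
  (forall n, linear (J n)) -> (forall n x, hnorm (J n x) <= hnorm x) ->
  exists (K : hilbertType R) (iota : forall n, H n -> K) (iotaoo : Hoo -> K),
    [/\ forall n, isometric (iota n), isometric iotaoo
      & forall n x y, complex.Re (dotp (iota n x) (iotaoo y)) =
                      complex.Re (dotp (J n x) y)].
Proof.
move=> Jlin Jle.
have [|U Ulin UP] := l2_embedding (dotp_positive Hoo).
  by move=> x; rewrite quad_dotp.
have VE n : exists V : H n -> l2 R,
    linear V /\ forall x, quad l2_dot (V x) = hnorm x ^+ 2 - hnorm (J n x) ^+ 2.
  have [|V Vlin VP] := l2_embedding (defect_form_positive (Jlin n) (Jle n)).
    by move=> x; rewrite quad_defect_form gerBl sqr_ge0.
  by exists V; split=> // x; rewrite VP quad_defect_form.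
(* A dependent choice: the domain of [V n] varies with n. *)
pose V n := projT1 (cid (VE n)); have VP n := projT2 (cid (VE n)).
pose iota n (x : H n) : l2 R := interleave (U (J n x)) (V n x).
pose iotaoo (y : Hoo) : l2 R := interleave (U y) 0.
have quad0 : quad l2_dot (0 : l2 R) = 0.
  by rewrite -(scale0r 0) (quadZ l2_dot_positive) /normsq/= expr0n addr0 mul0r.
have isoP (H' : hilbertType R) (f : H' -> l2 R) : linear f ->
    (forall x, quad l2_dot (f x) = hnorm x ^+ 2) -> isometric f.
  move=> flin fP; split=> // x.
  by rewrite l2_normE fP sqrtr_sqr ger0_norm ?hnorm_ge0// -normE.
have iota_iso n : isometric (iota n).
  have [Vlin Vq] := VP n; rewrite -/(V n) in Vlin Vq; apply: isoP => [a x y|x].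
    by rewrite /iota Jlin Ulin Vlin interleave_lin.
  by rewrite quad_interleave UP quad_dotp Vq addrC subrK.
have iotaoo_iso : isometric iotaoo.
  apply: isoP => [a x y|x].
    by rewrite /iotaoo -interleave_lin Ulin scaler0 addr0.
  by rewrite quad_interleave UP quad_dotp quad0 addr0.
exists (l2 R), iota, iotaoo; split=> // n x y.
have [_ Vq] := VP n; rewrite -/(V n) in Vq.
(* The embeddings are known only through [quad], so the inner product is recovered by
   polarisation. *)
have : quad l2_dot (iota n x + iotaoo y) =
    quad dotp (J n x + y) + quad l2_dot (V n x).
  have := interleave_lin 1 (U (J n x)) (U y) (V n x) 0.
  rewrite !scale1r addr0 => <-.
  rewrite quad_interleave -(linear_apD Ulin) UP//.
rewrite (quadD l2_dot_positive) (quadD (dotp_positive _)).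
rewrite !quad_interleave !UP quad0 !quad_dotp addr0 => h.
have {}h : 2 * complex.Re (l2_dot (iota n x) (iotaoo y)) =
           2 * complex.Re (dotp (J n x) y) by lra.
by apply: mulfI h.
Qed.

End Dilation.

(** * The resolvent estimate *)

Section WeidmannEstimate.
Context {R : realType} {Hn Hoo K : hilbertType R}.
Context (J : Hn -> Hoo) (iota : Hn -> K) (iotaoo : Hoo -> K).
Context (Rn : Hn -> Hn) (Roo : Hoo -> Hoo) (d : R).
Hypotheses (Jb : bounded_linear J) (Rnb : bounded_linear Rn) (Roob : bounded_linear Roo).
Hypotheses (J1 : opnorm J <= 1) (d0 : 0 <= d).
Hypotheses (iota_iso : isometric iota) (iotaoo_iso : isometric iotaoo).
Hypothesis iota_dotp : forall x y,
  complex.Re (dotp (iota x) (iotaoo y)) = complex.Re (dotp (J x) y).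
Hypothesis near_unitary : opnorm ((idfun \- (adjoint J \o J)) \o Rn) <= d.
Hypothesis near_unitary_adj :
  opnorm ((idfun \- (J \o adjoint J)) \o adjoint Roo) <= d.
Hypothesis intertwine : opnorm ((Roo \o J) \- (J \o Rn)) <= d.

Let J_le x : hnorm (J x) <= hnorm x.
Proof. by have := le_of_opnorm x Jb J1; rewrite mul1r. Qed.

Let adjJb : bounded_linear (adjoint J).
Proof. exact: adjoint_bounded. Qed.

Let adjJ_le y : hnorm (adjoint J y) <= hnorm y.
Proof.
rewrite -[leRHS]mul1r; apply: adjoint_le => // x.
by rewrite mul1r J_le.
Qed.

Let near_unitary_le x : hnorm (Rn x - adjoint J (J (Rn x))) <= d * hnorm x.
Proof.
apply: le_of_opnorm near_unitary; apply: bounded_linear_comp => //.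
by apply: bounded_linear_sub; [exact: bounded_linear_id|exact: bounded_linear_comp].
Qed.

Let near_unitary_adj_le y :
  hnorm (adjoint Roo y - J (adjoint J (adjoint Roo y))) <= d * hnorm y.
Proof.
apply: le_of_opnorm near_unitary_adj; apply: bounded_linear_comp.
  by apply: bounded_linear_sub; [exact: bounded_linear_id|exact: bounded_linear_comp].
exact: adjoint_bounded.
Qed.

Let intertwine_le x : hnorm (Roo (J x) - J (Rn x)) <= d * hnorm x.
Proof.
by apply: le_of_opnorm intertwine; apply: bounded_linear_sub; exact: bounded_linear_comp.
Qed.

Let r := opnorm Roo.

Let r0 : 0 <= r. Proof. exact: opnorm_ge0. Qed.

Let adjRoo_le y : hnorm (adjoint Roo y) <= r * hnorm y.
Proof. by apply: adjoint_le => // x; exact: le_opnorm. Qed.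

(* Rn = (1 - J^* J) Rn + J^* (J Rn - Roo J) + J^* Roo J *)
Let Rn_le x : hnorm (Rn x) <= (r + 2 * d) * hnorm x.
Proof.
have -> : Rn x = (Rn x - adjoint J (J (Rn x)))
    + (adjoint J (Roo (J x)) - adjoint J (Roo (J x) - J (Rn x))).
  by case: adjJb => adjJlin _; rewrite (linear_apB adjJlin) subKr subrK.
apply: le_trans (hnormD_le _ _) _.
have h1 := near_unitary_le x.
have h2 : hnorm (adjoint J (Roo (J x))) <= r * hnorm x.
  apply: le_trans (adjJ_le _) _; apply: le_trans (le_opnorm _ Roob) _.
  by rewrite ler_wpM2l.
have h3 := le_trans (adjJ_le (Roo (J x) - J (Rn x))) (intertwine_le x).
have := hnormD_le (adjoint J (Roo (J x))) (- adjoint J (Roo (J x) - J (Rn x))).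
by rewrite hnormN; lra.
Qed.

(** The common bound for the two outer terms of the splitting. *)
Let s := Num.sqrt (d * (r + 2 * d)).

Let sqr_s : s ^+ 2 = d * (r + 2 * d).
Proof. by rewrite sqr_sqrtr// mulr_ge0// addr_ge0 ?mulr_ge0. Qed.

(** By Cauchy-Schwarz the squared defect <(1 - J^* J) u, u> at [u = Rn x] is at most the product of
    d |x| (near unitarity) and (r + 2 d) |x| ([Rn_le]). *)
Let iota_defect x : hnorm (iota (Rn x) - iotaoo (J (Rn x))) <= s * hnorm x.
Proof.
rewrite -(ler_pXn2r (_ : 0 < 2)%N) ?nnegrE ?mulr_ge0 ?sqrtr_ge0 ?hnorm_ge0//.
set u := Rn x.
have -> : hnorm (iota u - iotaoo (J u)) ^+ 2 = complex.Re (dotp (u - adjoint J (J u)) u).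
  rewrite -quad_dotp (quadB (dotp_positive K)) !quad_dotp (isometric_hnorm _ iota_iso)
    (isometric_hnorm _ iotaoo_iso) iota_dotp.
  rewrite (positive_formDl (dotp_positive _)) (positive_formNl (dotp_positive _)).
  rewrite ReB (adjointPl Jb).
  rewrite -[complex.Re (dotp u u)]/(quad dotp u) !quad_dotp.
  by rewrite -[complex.Re (dotp (J u) _)]/(quad dotp (J u)) quad_dotp; ring.
apply: le_trans (Re_dotp_le _ _) _; rewrite exprMn sqr_s.
apply: (@le_trans _ _ ((d * hnorm x) * ((r + 2 * d) * hnorm x))).
  by apply: ler_pM; rewrite ?hnorm_ge0 ?near_unitary_le ?Rn_le.
by rewrite le_eqVlt; apply/orP; left; apply/eqP; ring.
Qed.

(** Here |Roo^* y| is at most r |y|, which gives the constant d r; it is enlarged to the square of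
    [s] for a common bound. *)
Let iotaoo_defect y : hnorm (iota (adjoint J (adjoint Roo y)) - iotaoo (adjoint Roo y))
  <= s * hnorm y.
Proof.
rewrite -(ler_pXn2r (_ : 0 < 2)%N) ?nnegrE ?mulr_ge0 ?sqrtr_ge0 ?hnorm_ge0//.
set u := adjoint Roo y.
have -> : hnorm (iota (adjoint J u) - iotaoo u) ^+ 2 =
    complex.Re (dotp (u - J (adjoint J u)) u).
  rewrite -quad_dotp (quadB (dotp_positive K)) !quad_dotp (isometric_hnorm _ iota_iso)
    (isometric_hnorm _ iotaoo_iso) iota_dotp.
  rewrite (positive_formDl (dotp_positive _)) (positive_formNl (dotp_positive _)).
  rewrite ReB (adjointP Jb).
  rewrite -[complex.Re (dotp u u)]/(quad dotp u) !quad_dotp.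
  rewrite -[complex.Re (dotp (adjoint J u) _)]/(quad dotp (adjoint J u)) quad_dotp.
  ring.
apply: le_trans (Re_dotp_le _ _) _; rewrite exprMn sqr_s.
apply: (@le_trans _ _ ((d * hnorm y) * (r * hnorm y))).
  by apply: ler_pM; rewrite ?hnorm_ge0 ?near_unitary_adj_le ?adjRoo_le.
have -> : d * hnorm y * (r * hnorm y) = d * r * hnorm y ^+ 2 by ring.
by rewrite ler_wpM2r ?sqr_ge0// ler_wpM2l// lerDl mulr_ge0.
Qed.

(** The three terms of the splitting contribute [s], [d] and [s]. *)
Lemma dilated_resolvent_le :
  opnorm ((iota \o Rn \o adjoint iota) \- (iotaoo \o Roo \o adjoint iotaoo))
    <= Num.sqrt d * (2 * Num.sqrt (r + 2 * d) + Num.sqrt d).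
Proof.
have -> : Num.sqrt d * (2 * Num.sqrt (r + 2 * d) + Num.sqrt d) = 2 * s + d.
  by rewrite /s sqrtrM// mulrDr -[X in _ + X]expr2 sqr_sqrtr//; ring.
have s0 : 0 <= s := sqrtr_ge0 _.
apply: opnorm_le; first by rewrite addr_ge0 ?mulr_ge0.
move=> y /=.
have iotab := isometric_bounded iota_iso; have iotaoob := isometric_bounded iotaoo_iso.
have adj_iota_le z : hnorm (adjoint iota z) <= hnorm z.
  rewrite -[leRHS]mul1r; apply: adjoint_le => // x.
  by rewrite mul1r isometric_hnorm.
set x := adjoint iota y; set x' := adjoint iotaoo y.
have [iotaoolin _] := iotaoo_iso; have [Roolin _] := Roob.
(* Telescoping through [iotaoo (J (Rn x))] and [iotaoo (Roo (J x))]. *)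
have -> : iota (Rn x) - iotaoo (Roo x') =
    (iota (Rn x) - iotaoo (J (Rn x))) - iotaoo (Roo (J x) - J (Rn x))
    + iotaoo (Roo (J x - x')).
  rewrite (linear_apB iotaoolin) (linear_apB Roolin) (linear_apB iotaoolin).
  by rewrite opprB !addrA !subrK.
have h1 : hnorm (iota (Rn x) - iotaoo (J (Rn x))) <= s * hnorm y.
  by apply: le_trans (iota_defect _) _; rewrite ler_wpM2l ?adj_iota_le.
have h2 : hnorm (iotaoo (Roo (J x) - J (Rn x))) <= d * hnorm y.
  rewrite isometric_hnorm//; apply: le_trans (intertwine_le _) _.
  by rewrite ler_wpM2l ?adj_iota_le.
have h3 : hnorm (iotaoo (Roo (J x - x'))) <= s * hnorm y.
  (* estimated through its adjoint, to which iotaoo_defect applies *)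
  rewrite isometric_hnorm//.
  apply: hnorm_le_of_dotp; first by rewrite mulr_ge0 ?hnorm_ge0.
  set h := Roo (J x - x').
  have -> : complex.Re (dotp h h) =
      complex.Re (dotp y (iota (adjoint J (adjoint Roo h)) - iotaoo (adjoint Roo h))).
    rewrite {1}/h (adjointP Roob); set g := adjoint Roo h.
    rewrite (positive_formDl (dotp_positive _)) (positive_formNl (dotp_positive _)).
    rewrite (positive_formDr (dotp_positive _)) (positive_formNr (dotp_positive _)).
    by rewrite (adjointP Jb) (adjointPl iotab) (adjointPl iotaoob).
  apply: le_trans (Re_dotp_le _ _) _.
  rewrite mulrAC mulrC; apply: ler_wpM2r; first exact: hnorm_ge0.
  exact: iotaoo_defect.
apply: le_trans (hnormD_le _ _) _.
have := hnormD_le (iota (Rn x) - iotaoo (J (Rn x))) (- iotaoo (Roo (J x) - J (Rn x))).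
by rewrite hnormN; lra.
Qed.

End WeidmannEstimate.

(** * Resolvents at real points, and the conclusion *)

Section Resolvents.
Context {R : realType} {H : hilbertType R}.

Lemma resolventP (A : operator H) z : resolvent_set A z ->
  is_resolvent A z (resolvent A z).
Proof. by move=> [S SP]; apply: (@xgetPex _ _ [set S | is_resolvent A z S]); exists S. Qed.

(** Quasi-unitarity for adjoint resolvents is assumed only at nonreal points. At a real one the
    resolvent S is its own adjoint, by symmetry of A - z on the vectors S f and S g. *)
Lemma adjoint_resolvent_real (A : operator H) z : self_adjoint A ->
  z \is Num.real -> resolvent_set A z -> adjoint (resolvent A z) = resolvent A z.
Proof.
move=> [_ Asa] zreal /resolventP[/bounded_op_linear Sb SP _].
apply: adjoint_unique => // f g.
have [domf fE] := SP f; have [domg gE] := SP g.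
set u := resolvent A z f in domf fE *; set v := resolvent A z g in domg gE *.
have Asym : dotp (A u) v = dotp u (A v).
  have : adjoint_graph A (v, A v) by rewrite Asa.
  by move=> /(_ u domf).
rewrite -fE -gE (positive_formDr (dotp_positive H)) (positive_formDl (dotp_positive H)).
rewrite (positive_formNl (dotp_positive H)) (positive_formNr (dotp_positive H)).
rewrite (positive_formZl (dotp_positive H)) (positive_formZr (dotp_positive H)).
by rewrite Asym (CrealP zreal).
Qed.

End Resolvents.

Theorem corollary3p2 (R : realType)
    (H : nat -> hilbertType R) (Hoo : hilbertType R)
    (A : forall n : nat, operator (H n)) (Aoo : operator Hoo)
    (z0 : R[i]) (J : forall n : nat, H n -> Hoo) (delta : nat -> R)
    (A_sa : forall n : nat, self_adjoint (A n)) (Aoo_sa : self_adjoint Aoo)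
    (A_que : que_converges A Aoo z0 J delta)
    (J_contraction : forall n : nat, opnorm (J n) <= 1) :
  let delta' := fun n : nat =>
    Num.sqrt (delta n) *
      (2 * Num.sqrt (opnorm (resolvent Aoo z0) + 2 * delta n)
       + Num.sqrt (delta n)) in
  weidmann_converges A Aoo z0 delta' /\
  (delta' : nat -> R^o) =O_\oo (fun n : nat => Num.sqrt (delta n) : R^o).
Proof.
move=> delta'.
have [[delta0 delta_cvg] [A_rho Aoo_rho] Jbop A_quasi] := A_que.
have Jb n : bounded_linear (J n) by exact: bounded_op_linear.
have sqrt_cvg (u : nat -> R) (l : R) :
    u @ \oo --> l -> (fun n => Num.sqrt (u n)) @ \oo --> Num.sqrt l.
  by move=> ul; apply: continuous_cvg ul; exact: sqrt_continuous.
(* The second factor of [delta'] converges; hence [delta'] tends to 0, and the factor is eventually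
   bounded, as the O estimate requires. *)
have [l factor_cvg] : exists l : R,
    (fun n => 2 * Num.sqrt (opnorm (resolvent Aoo z0) + 2 * delta n)
              + Num.sqrt (delta n)) @ \oo --> l.
  exists (2 * Num.sqrt (opnorm (resolvent Aoo z0) + 2 * 0) + Num.sqrt 0).
  apply: cvgD; last exact: sqrt_cvg.
  apply: cvgM; first exact: cvg_cst.
  apply: sqrt_cvg; apply: cvgD; first exact: cvg_cst.
  by apply: cvgM => //; exact: cvg_cst.
have delta'_cvg : delta' @ \oo --> Num.sqrt (0 : R) * l.
  by apply: cvgM => //; exact: sqrt_cvg.
split.
  split=> //.
    split=> [n|].
      by rewrite /delta' mulr_ge0 ?addr_ge0 ?mulr_ge0 ?sqrtr_ge0.
    by move: delta'_cvg; rewrite sqrtr0 mul0r.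
  have [|n x|K [iota [iotaoo [iota_iso iotaoo_iso iota_dotp]]]] :=
    @common_dilation R H Hoo J.
  - by move=> n; case: (Jb n).
  - by have := le_of_opnorm x (Jb n) (J_contraction n); rewrite mul1r.
  exists K, iota, iotaoo; split=> // n.
  have [_ [unitary unitary' intertwine] quasi_adj] := A_quasi n.
  have [Rnb _ _] := resolventP (A_rho n).
  have [Roob _ _] := resolventP Aoo_rho.
  apply: (dilated_resolvent_le (Jb n)) => //; try exact: bounded_op_linear.
  (* The estimate needs near unitarity for the adjoint of the limit resolvent: a hypothesis at
     nonreal [z0], self-adjointness of the resolvent at real [z0]. *)
  have [zreal|znreal] := boolP (z0 \is Num.real); last by have [_] := quasi_adj znreal.
  by rewrite adjoint_resolvent_real.
(* Eventually the convergent factor lies within 1 of its limit [l]. *)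
apply/eqO_exP; exists (`|l| + 1); first by rewrite ltr_wpDl.
have bound (c : R) : `|l - c| <= 1 -> `|c| <= `|l| + 1.
  by move=> lc; rewrite -[c](subKr l) (le_trans (ler_normB _ _))// lerD2l.
have /cvgrPdist_le/(_ 1 ltr01) := factor_cvg.
apply: filterS => n /= /bound nl.
by rewrite /delta' normrM mulrC ler_wpM2r.
Qed.
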